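(* Let $X$ be a set, $\operatorname{dom}(\ell)\subset X^\omega$ a countable set of sequences in $X$, and $\ell:\operatorname{dom}(\ell)\to X$ a function. The following conditions are equivalent: (1) $X$ admits a metrizable topology $\tau$ in which every sequence $s\in\operatorname{dom}(\ell)$ converges to the point $\ell(s)$. (2) $X$ admits a Hausdorff topology $\tau$ in which every sequence $s\in\operatorname{dom}(\ell)$ converges to the point $\ell(s)$. (3) The following two properties are satisfied: (3a) for any $s\in\operatorname{dom}(\ell)$ and $x\in X$ with $x\ne\ell(s)$ the set $\{n\in\omega:s_n=x\}$ is finite; (3b) for any sequences $s,t\in\operatorname{dom}(\ell)$ with $\ell(s)\ne\ell(t)$ there exists a finite set $F\subset\omega$ such that $s_n\ne t_m$ for any $n,m\in\omega\setminus F$.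
   Context: $X^\omega$ is the set of all sequences $s=(s_n)_{n\in\omega}$ of elements of $X$. *)

(* Defs.v *)
From HB Require Import structures.
From mathcomp Require Import all_boot all_order all_algebra.
From mathcomp Require Import all_classical all_reals.
From mathcomp Require Import topology.

Set Implicit Arguments.
Unset Strict Implicit.
Unset Printing Implicit Defensive.

Local Open Scope classical_set_scope.

(* A topology on the bare type [X] is an inhabitant [tau] of the class
   [Topological X] (which also contains a choice operator on [X]; this is no
   restriction, since every type has one classically).
   [topspace tau] is [X] equipped with [tau]. *)
Definition topspace (X : Type) (tau : Topological X) : topologicalType :=
  @Topological.Pack X tau.

Definition metrizable (R : realType) (T : topologicalType) : Prop :=
  exists m : Metric R T, forall A : set T,
    @open T A <-> @open (@Metric.Pack R T m) A.

Definition all_converge (X : Type) (D : set (nat -> X)) (ell : D -> X)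
    (tau : Topological X) : Prop :=
  forall s : D, (sval s : nat -> topspace tau) @ \oo --> (ell s : topspace tau).

(* Main.v *)
(** (3) => (1). Call a set sequentially closed if a sequence of [D] whose limit
    lies outside it is eventually outside it. Singletons are sequentially closed
    by (3a), and so is a tail of a sequence of [D] together with its limit, by
    (3a) and (3b). Hence two disjoint sequentially closed sets [A], [B] can be
    enlarged, staying disjoint and sequentially closed, so that one of them
    swallows a tail of a given sequence of [D] and its limit. Doing this along an
    enumeration of [D], starting from [{a}] and [{b}], yields in the limit a set
    [U] that separates [a] from [b] and whose indicator is eventually constant
    along each sequence of [D], with the value taken at the limit. Countably many
    such sets separate the countable set of all terms and limits; the points
    outside of it can be isolated. The resulting sequence of equivalence relations
    defines an ultrametric in which all the sequences converge. *)
Require Import Defs.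
From HB Require Import structures.
From mathcomp Require Import all_boot all_order all_algebra.
From mathcomp Require Import all_classical all_reals.
From mathcomp Require Import topology.

Local Open Scope classical_set_scope.

Import Order.TTheory GRing.Theory Num.Theory.

(** * Finite and cofinite sets of indices *)

Lemma finite_near_infty (F : set nat) :
  finite_set F -> \forall n \near \oo, ~ F n.
Proof.
move=> /finite_seqP[r ->]; exists (\max_(i <- r) i).+1 => // n /= nr rn.
by move: nr; rewrite ltnNge leq_bigmax_seq.
Qed.

Lemma near_infty_finite (F : set nat) :
  (\forall n \near \oo, ~ F n) -> finite_set F.
Proof.
move=> [N _ FN]; apply: sub_finite_set (finite_II N) => n Fn /=.
by rewrite ltnNge; apply/negP => /FN.
Qed.

Lemma near_infty_forall_lt (M : nat) (P : nat -> nat -> Prop) :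
  (forall m, \forall n \near \oo, P m n) ->
  \forall n \near \oo, forall m, (m < M)%N -> P m n.
Proof.
move=> PP; have : \forall n \near \oo, forall m : 'I_M, P m n.
  by apply: filter_forall => m; exact: PP.
by apply: filterS => n Pn m mM; exact: Pn (Ordinal mM).
Qed.

(** * Sequentially closed sets and separation of points *)

Section separation.
Context {X I : Type} {s : I -> nat -> X} {l : I -> X}.
Hypothesis s_fin : forall i x, x <> l i -> finite_set [set n | s i n = x].
Hypothesis s_disj : forall i j, l i <> l j ->
  exists F : set nat, finite_set F /\
    forall n m, ~ F n -> ~ F m -> s i n <> s j m.

Definition seq_closed (A : set X) : Prop :=
  forall i, ~ A (l i) -> \forall n \near \oo, ~ A (s i n).

Definition tail (i : I) (N : nat) : set X :=
  l i |` [set s i n | n in [set n | (N <= n)%N]].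

Lemma seq_closed1 (x : X) : seq_closed [set x].
Proof. by move=> i /= /nesym/s_fin/finite_near_infty. Qed.

Lemma seq_closedU (A B : set X) :
  seq_closed A -> seq_closed B -> seq_closed (A `|` B).
Proof.
move=> cA cB i /not_orP[/cA nA /cB nB].
by near=> n; case; [near: n|near: n].
Unshelve. all: by end_near.
Qed.

(** Beyond a finite set of indices, all below some [M], the two sequences never meet by [s_disj].
    What remains is [l i] and the finitely many [s i m] with [N <= m < M]; all differ from [l j], so
    [s j] takes each of these values finitely often. *)
Lemma seq_closed_tail (i : I) (N : nat) : seq_closed (tail i N).
Proof.
move=> j /not_orP[/= lji ljs].
have [F [finF sF]] := s_disj _ _ lji.
have [M _ FM] := finite_near_infty _ finF.
have sj_ni : \forall n \near \oo, s j n <> l i.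
  exact/finite_near_infty/s_fin/nesym.
have sj_nF : \forall n \near \oo, forall m, (m < M)%N ->
    (N <= m)%N -> s j n <> s i m.
  apply: near_infty_forall_lt => m.
  have [Nm|mN] := leqP N m; last by near=> n.
  have /s_fin/finite_near_infty : s i m <> l j.
    by move=> ijm; apply: ljs; exists m.
  exact: filterS.
near=> n.
case=> [|[m /= Nm] /esym]; first by near: n.
have [mM|Mm] := ltnP m M; first by move: m mM Nm; near: n.
apply: sF; last exact: FM.
by near: n; exact: finite_near_infty.
Unshelve. all: by end_near. Qed.

Lemma seq_closed_absorb (A B : set X) (i : I) :
  seq_closed A -> seq_closed B -> A `&` B = set0 -> ~ B (l i) ->
  exists N, seq_closed (A `|` tail i N) /\ (A `|` tail i N) `&` B = set0.
Proof.
move=> cA cB AB0 Bi; have [N _ BN] := cB i Bi; exists N; split.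
  exact: seq_closedU cA (seq_closed_tail _ _).
by rewrite setIUl AB0 set0U; apply/seteqP; split=> // x [[->//|[n /BN + <-]]].
Qed.

Definition closed_pair (p : set X * set X) : Prop :=
  [/\ seq_closed p.1, seq_closed p.2 & p.1 `&` p.2 = set0].

Definition absorbs (i : I) (p q : set X * set X) : Prop :=
  [/\ p.1 `<=` q.1, p.2 `<=` q.2 &
      exists N, tail i N `<=` q.1 \/ tail i N `<=` q.2].

Lemma closed_pair_absorb (i : I) (p : set X * set X) :
  closed_pair p -> exists q, closed_pair q /\ absorbs i p q.
Proof.
case: p => A B [/= cA cB AB0].
(* By disjointness [l i] lies outside [A] or outside [B]; the tail joins the other set. *)
have [Bi|nBi] := pselect (B (l i)).
  have nAi : ~ A (l i) by move=> Ai; rewrite -[False]/(set0 (l i)) -AB0.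
  have BA0 : B `&` A = set0 by rewrite setIC.
  have [N [cB' BA]] := seq_closed_absorb _ _ _ cB cA BA0 nAi.
  exists (A, B `|` tail i N); split; split => //=; first by rewrite setIC.
  by exists N; right.
have [N [cA' AB]] := seq_closed_absorb _ _ _ cA cB AB0 nBi.
exists (A `|` tail i N, B); split; split => //=.
by exists N; left.
Qed.

End separation.

Lemma clopen_separation {X : Type} {s : nat -> nat -> X} {l : nat -> X} :
  (forall i x, x <> l i -> finite_set [set n | s i n = x]) ->
  (forall i j, l i <> l j -> exists F : set nat, finite_set F /\
     forall n m, ~ F n -> ~ F m -> s i n <> s j m) ->
  forall a b, a <> b -> exists U : set X,
    [/\ U a, ~ U b & forall i, \forall n \near \oo, U (s i n) <-> U (l i)].
Proof.
move=> s_fin s_disj a b ab.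
(* The closedness premise sits under the existential so that [choice] yields a total function. *)
have step (x : nat * (set X * set X)) : exists q, @closed_pair _ _ s l x.2 ->
    @closed_pair _ _ s l q /\ @absorbs _ _ s l x.1 x.2 q.
  have [cx|] := pselect (@closed_pair _ _ s l x.2); last by exists x.2.
  by have [q] := closed_pair_absorb s_fin s_disj x.1 _ cx; exists q.
have [f fP] := choice step.
pose P := fix P n := if n is m.+1 then f (m, P m) else ([set a], [set b]).
have cP n : @closed_pair _ _ s l (P n).
  elim: n => [|n /(fP (n, P n))[]//]; split; try exact: seq_closed1.
  by apply/seteqP; split=> // x [/= ->].
have Pabs n := (fP (n, P n) (cP n)).2.
have P1 m n : (m <= n)%N -> (P m).1 `<=` (P n).1.
  move=> /subnK <-; elim: (n - m)%N => // k IH x /IH.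
  by have [+ _ _] := Pabs (k + m)%N; apply.
have P2 m n : (m <= n)%N -> (P m).2 `<=` (P n).2.
  move=> /subnK <-; elim: (n - m)%N => // k IH x /IH.
  by have [_ + _] := Pabs (k + m)%N; apply.
have P12 m n x : (P m).1 x -> (P n).2 x -> False.
  move=> /(P1 _ _ (leq_maxl m n)) h1 /(P2 _ _ (leq_maxr m n)) h2.
  have [_ _ P0] := cP (maxn m n).
  by rewrite -[False]/(set0 x) -P0.
exists (\bigcup_n (P n).1); split; first by exists 0%N.
  by move=> [n _ /P12/(_ (_ : (P 0%N).2 b))]; exact.
(* Stage [i] put a tail of [s i] and its limit into one component: the first lies inside the union,
   the second is disjoint from it by [P12]. *)
move=> i; have [_ _ [N [sub|sub]]] := Pabs i.
  exists N => // n Nn; split=> _; exists i.+1 => //; apply: sub; first by left.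
  by right; exists n.
exists N => // n Nn; split=> -[m _ /P12/(_ (_ : (P i.+1).2 _))]; case; apply: sub.
  by right; exists n.
by left.
Qed.

Section first_difference_metric.
Context {R : realType} {X : Type} {E : nat -> X -> X -> Prop}.
Local Open Scope ring_scope.

(** The shift by one matters: as [0^-1 = 0], a difference at index 0 would otherwise give distance
    0. *)
Definition first_difference_dist (x y : X) : R :=
  match pselect (exists k, `[< ~ E k x y >]) with
  | left ex => (ex_minn ex).+1%:R^-1
  | right _ => 0
  end.

Lemma first_difference_dist_ge k x y :
  ~ E k x y -> k.+1%:R^-1 <= first_difference_dist x y.
Proof.
move=> nE; rewrite /first_difference_dist; case: pselect => [ex|]; last first.
  by case; exists k; apply/asboolP.
case: ex_minnP => m _ /(_ k (introT (asboolP _) nE)) mk.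
by rewrite lef_pV2 ?posrE ?ltr0n// ler_nat.
Qed.

Lemma first_difference_distP x y : first_difference_dist x y = 0 \/
  exists2 k, ~ E k x y & first_difference_dist x y = k.+1%:R^-1.
Proof.
rewrite /first_difference_dist; case: pselect => [ex|]; last by left.
by case: ex_minnP => m /asboolP nE _; right; exists m.
Qed.

Lemma first_difference_dist_ge0 x y : 0 <= first_difference_dist x y.
Proof.
by have [->|[k _ ->]] := first_difference_distP x y; rewrite ?invr_ge0.
Qed.

Lemma first_difference_metrizable :
  (forall k x, E k x x) -> (forall k x y, E k x y -> E k y x) ->
  (forall k y x z, E k x y -> E k y z -> E k x z) ->
  (forall x y, (forall k, E k x y) -> x = y) ->
  exists tau : Topological X, metrizable R (topspace tau) /\
    forall (u : nat -> X) (a : X),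
      (forall k, \forall n \near \oo, E k a (u n)) ->
      (u : nat -> topspace tau) @ \oo --> (a : topspace tau).
Proof.
move=> Exx Esym Etrans Esep.
pose d := first_difference_dist.
have dxx x : d x x = 0.
  by have [//|[k /(_ (Exx k x))]] := first_difference_distP x x.
have d_pos x y : d x y = 0 -> x = y.
  move=> dxy; apply: Esep => k; apply: contrapT.
  by move=> /first_difference_dist_ge; rewrite -/(d x y) dxy leNgt invr_gt0 ltr0n.
have d_le x y : d x y <= d y x.
  have [e|[k nE e]] := first_difference_distP x y; rewrite /d e.
    exact: first_difference_dist_ge0.
  by apply: first_difference_dist_ge => /Esym.
have d_sym x y : d x y = d y x by apply/eqP; rewrite eq_le !d_le.
have d_tri y x z : d x z <= d x y + d y z.
  have [e|[k nE e]] := first_difference_distP x z; rewrite /d e.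
    by rewrite addr_ge0// first_difference_dist_ge0.
  (* By transitivity [E k] fails for [x, y] or for [y, z], so one summand alone is large enough. *)
  have [Exy|nxy] := pselect (E k x y).
    apply: ler_wpDl; first exact: first_difference_dist_ge0.
    by apply: first_difference_dist_ge => /(Etrans _ _ _ _ Exy).
  apply: ler_wpDr; first exact: first_difference_dist_ge0.
  exact: first_difference_dist_ge.
pose dM := isMetric.Build R {classic X} dxx d_pos d_sym d_tri.
pose M : metricType R := HB.pack {classic X} dM.
exists (Topological.class M); split; first by exists (Metric.class M).
move=> u a uE.
apply/(@cvg_ballP R M) => e e0.
have [N Ne] : exists N, N.+1%:R^-1 < e.
  exists (Num.truncn e^-1).
  by rewrite invf_plt ?posrE// truncnS_gt// invr_ge0 ltW.
(* Agreement at all indices below [N] bounds the distance by [1/(N+1)]. *)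
have := near_infty_forall_lt N _ uE; apply: filterS => n En.
rewrite (@ballEmdist R M) /= -[mdist _ _]/(d a (u n)).
have [e'|[k nE e']] := first_difference_distP a (u n); rewrite /d e'//.
apply: le_lt_trans Ne; rewrite lef_pV2 ?posrE ?ltr0n// ler_nat ltnS leqNgt.
by apply/negP => /En.
Qed.

End first_difference_metric.

Lemma metrizable_of_clopen_separation {R : realType} {X : Type}
    {s : nat -> nat -> X} {l : nat -> X} :
  (forall a b, a <> b -> exists U : set X,
    [/\ U a, ~ U b & forall i, \forall n \near \oo, U (s i n) <-> U (l i)]) ->
  exists tau : Topological X, metrizable R (topspace tau) /\
    forall i, (s i : nat -> topspace tau) @ \oo --> (l i : topspace tau).
Proof.
move=> sep.
(* Codes for all limits and terms; pairs of codes are countable, so [pickle] numbers the pairs of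
   points to be separated. *)
pose g (p : nat + nat * nat) : X :=
  match p with inl i => l i | inr (i, n) => s i n end.
have sepU (x : X * X) : exists U : set X, (x.1 <> x.2 -> U x.1 /\ ~ U x.2) /\
    forall i, \forall n \near \oo, U (s i n) <-> U (l i).
  have [e|/sep[U [Ua Ub UP]]] := pselect (x.1 = x.2); last by exists U.
  by exists set0; split=> // i; near=> n.
have [U UP] := choice sepU.
pose V k : set X := if unpickle k is Some (p, q) then U (g p, g q) else set0.
pose C := range g.
(* A point outside [C] is related only to itself, hence is at distance 1 from every other point. *)
pose E k x y := x = y \/ [/\ C x, C y & V k x <-> V k y].
have [||||tau [mtau tauP]] := @first_difference_metrizable R X E.
- by left.
- by move=> k x y [->|[Cx Cy Vxy]]; [left|right; split => //; exact: iff_sym].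
- move=> k y x z [->//|[Cx Cy Vxy]] [<-|[_ Cz Vyz]]; right; split=> //.
  exact: iff_trans Vxy Vyz.
- move=> x y Exy; apply: contrapT => xy.
  have [//|[[p _ px] [q _ qy] _]] := Exy 0%N.
  have [//|[_ _]] := Exy (pickle (p, q)).
  rewrite /V pickleK px qy => -[Vxy _].
  by have [/(_ xy)[/Vxy]] := UP (x, y).
exists tau; split=> // i; apply: tauP => k.
have : \forall n \near \oo, V k (s i n) <-> V k (l i).
  rewrite /V; case: unpickle => [[p q]|]; last by near=> n.
  exact: (UP (g p, g q)).2.
apply: filterS => n Vn; right; split; last exact: iff_sym.
- by exists (inl i).
- by exists (inr (i, n)).
Unshelve. all: by end_near. Qed.

Lemma metrizable_hausdorff {R : realType} {T : topologicalType} :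
  metrizable R T -> hausdorff_space T.
Proof.
move=> [m openE]; have := @metric_hausdorff R (Metric.Pack m).
rewrite !open_hausdorff => H x y /eqP xy.
have xy' : (x : Metric.Pack m) != y by apply/eqP.
have [[A B] AB [/openE oA /openE oB AB0]] := H x y xy'.
by exists (A, B).
Qed.

(** Yields (3b) directly, and (3a) by taking [v] constant. *)
Lemma hausdorff_cvg_near_disjoint {T : topologicalType}
    (u v : nat -> T) (a b : T) :
  hausdorff_space T -> u @ \oo --> a -> v @ \oo --> b -> a <> b ->
  exists N, forall n m, (N <= n)%N -> (N <= m)%N -> u n <> v m.
Proof.
rewrite open_hausdorff => T2 ua vb /eqP/T2.
move=> [[A B] /= [/set_mem Aa /set_mem Bb] [oA oB /eqP AB0]].
have [N _ uN] := ua _ (open_nbhs_nbhs (conj oA Aa)).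
have [M _ vM] := vb _ (open_nbhs_nbhs (conj oB Bb)).
exists (maxn N M) => n m; rewrite !geq_max => /andP[/uN + _] /andP[_ /vM +] uv.
by rewrite /= uv => Avm Bvm; rewrite -[False]/(set0 (v m)) -AB0.
Qed.

Theorem theorem2p8 (R : realType) (X : Type) (D : set (nat -> X))
    (ell : D -> X) (D_countable : countable D) :
  [<-> exists tau : Topological X,
         metrizable R (topspace tau) /\ all_converge ell tau;
       exists tau : Topological X,
         hausdorff_space (topspace tau) /\ all_converge ell tau;
       (forall (s : D) (x : X), x <> ell s ->
          finite_set [set n : nat | sval s n = x])
       /\
       (forall s t : D, ell s <> ell t ->
          exists F : set nat, finite_set F /\
            forall n m : nat, ~ F n -> ~ F m -> sval s n <> sval t m)].
Proof.
tfae.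
- by move=> [tau [/metrizable_hausdorff mtau ctau]]; exists tau.
- move=> [tau [htau ctau]]; split=> [s x /nesym xs|s t st].
    have [N Nsx] := hausdorff_cvg_near_disjoint _ _ _ _ htau (ctau s)
      (@cvg_cst (topspace tau) x nat \oo _) xs.
    by apply: near_infty_finite; exists N => // n /Nsx/(_ (leqnn N)).
  have [N Nst] := hausdorff_cvg_near_disjoint _ _ _ _ htau (ctau s) (ctau t) st.
  exists `I_N; split; first exact: finite_II.
  by move=> n m /negP + /negP; rewrite -!leqNgt; exact: Nst.
- move=> [s_fin s_disj].
  (* An empty [D] has no enumeration by [nat]; there the discrete metric serves, with convergence
     vacuous. *)
  have [[t0]|noD] := pselect (inhabited D); last first.
    have [//|//|k y x z -> //|x y /(_ 0%N)//|tau [mtau _]] :=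
      @first_difference_metrizable R X (fun _ => eq).
    by exists tau; split=> // t; case: noD.
  have [f f_inj] := countable_injP _ D_countable.
  (* A left inverse of the injection [f] on [D]; indices that [f] misses on [D] are sent to [t0]. *)
  have enum i : exists t : D, forall t' : D, f (sval t') = i -> t = t'.
    have [[t ti]|no] := pselect (exists t : D, f (sval t) = i); last first.
      by exists t0 => t' t'i; case: no; exists t'.
    exists t => t' t'i; apply: val_inj; apply: f_inj; rewrite ?ti//.
    + exact: (valP t).
    + exact: (valP t').
  have [e eP] := choice enum.
  have [tau [mtau ctau]] := @metrizable_of_clopen_separation R X _ _
    (clopen_separation (fun i => s_fin (e i)) (fun i j => s_disj (e i) (e j))).
  exists tau; split=> // t.
  by rewrite -(eP (f (sval t)) t erefl); exact: ctau.
Qed.
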